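(* Let $0<\alpha_1\le\alpha_2\le\alpha_3\le\alpha_4$ be real numbers such that $\lambda=\alpha_1+\alpha_2+\alpha_3+\alpha_4$ satisfies $\lambda>2$ and $\alpha_i\le\frac{\lambda-\sqrt{\lambda^2-4}}2$ for $i=1,2,3,4$. Put $\delta_i=\sqrt{\alpha_i^2-\lambda\alpha_i+1}$ and assume $\delta_1\ge\delta_2\ge\delta_3\ge\delta_4>0$. Then the following are equivalent: 1. There exists a unitary matrix $u=(u_{ij})\in M_4(\mathbb C)$ such that $|u_{ii}|=\delta_i$ for all $i$ and $|u_{ij}|=\sqrt{\alpha_i\alpha_j}$ for all $i\neq j$. 2. $\delta_1-\delta_2-\delta_3-\delta_4\le0$ and $\delta_1-\delta_2-\delta_3+\delta_4\ge0$.
   Context: All notation is introduced in the claim. ($\frac12(\lambda-\sqrt{\lambda^2-4})$ is the smallest root of $x^2-\lambda x+1$, so the $\delta_i$ are well defined.) *)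

(* Defs.v *)
From mathcomp Require Export all_boot all_order all_algebra.
From mathcomp Require Export reals.
From mathcomp Require Export complex.

Set Implicit Arguments.
Unset Strict Implicit.
Unset Printing Implicit Defensive.

Import Order.TTheory GRing.Theory Num.Theory.

Local Open Scope ring_scope.

(* The indices 1, 2, 3, 4 are represented by 0, 1, 2, 3 : 'I_4. *)

Definition lambda (R : realType) (alpha : 'I_4 -> R) : R :=
  \sum_(i < 4) alpha i.

(* [Num.sqrt] is 0 on negative numbers; when every alpha_i is at most the
   smallest root of x^2 - lambda x + 1, the argument below is nonnegative. *)
Definition delta (R : realType) (alpha : 'I_4 -> R) (i : 'I_4) : R :=
  Num.sqrt (alpha i ^+ 2 - lambda alpha * alpha i + 1).

(* Main.v *)
Require Import Defs.
From mathcomp Require Import fingroup perm ring lra.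
From mathcomp Require Import classical_sets topology normedtype realfun.
Set Implicit Arguments.
Unset Strict Implicit.
Unset Printing Implicit Defensive.
Import Order.TTheory GRing.Theory Num.Theory.
Local Open Scope ring_scope.

(** Up to multiplying its rows by phases, every unitary u with the prescribed
    moduli has the form H + i s with s real and H Hermitian of trace 0. If h_i
    are the diagonal entries of H, then h_0 + h_1 + h_2 + h_3 = 0 and
    delta_i^2 = h_i^2 + s^2; the existence of such numbers h_i and s is what
    the two inequalities express.

    From (1) to (2). Jacobi's identity for complementary minors says that
      u_ik u_jl - u_il u_jk = det u * conj (u_ki u_lj - u_kj u_li)
    whenever {i,j,k,l} = {0,1,2,3} (unitary_minor_offdiag), and the four
    products in it have the same modulus. The left-hand side is nonzero
    (offdiag_minor_neq0): otherwise the last two terms of the orthogonality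
    relation u_ii conj u_ji + u_ij conj u_jj + u_ik conj u_jk + u_il conj u_jl = 0
    would be aligned, so that alpha_k + alpha_l <= delta_i + delta_j, whereas
    alpha_k + alpha_l = (lambda/2 - alpha_i) + (lambda/2 - alpha_j) and
    (lambda/2 - alpha_i)^2 = delta_i^2 + lambda^2/4 - 1 > delta_i^2.
    Comparing Jacobi's identity with its conjugate gives the value of
    y_ik y_jl y_il y_jk, where y_ij = u_ij u_ji; it depends only on det u and
    the alpha_i (twocycle_prod). Hence the products y_01 y_23, y_02 y_13 and
    y_03 y_12 coincide, which is the condition for the existence of phases e_i
    such that diag(e) u is Hermitian off the diagonal (phase_factors,
    hermitian_gauge). For such a matrix, comparing rows with columns shows
    that the imaginary part of the diagonal is constant, and Jacobi's identity
    shows first that the determinant is 1 and then, for another minor, that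
    the real parts of the diagonal entries add up to 0. The two inequalities
    follow from the triangle inequality for the vectors (h_i, s) of length
    delta_i and from the convexity of h |-> sqrt (h^2 + s^2)
    (sum0_diag_ineq).

    From (2) to (1). The intermediate value theorem gives s and h_i with
    delta_i^2 = h_i^2 + s^2 and sum 0 (sum0_of_diag_ineq). A Hermitian H with
    diagonal h and |H_ij| = sqrt (alpha_i alpha_j), normalized so that
    H_0j > 0, is determined by the phases f_3, f_1, f_2 of H_12, H_23, H_31.
    Orthogonality of row 0 to the other rows asks for three triangles, with
    sides |h_0 + h_j|, alpha_k, alpha_l for {j,k,l} = {1,2,3}, whose directions
    are given by f_1, f_2, f_3. The triangle with j = 3 determines f_1 and
    f_2 up to a common conjugation, and the one with j = 1 then gives f_3. That
    f_3 has modulus 1 and that the relation for j = 2 holds is automatic,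
    because the numbers h_0 + h_j satisfy the relations between the sides and
    the diagonals of a quadrilateral with sides alpha_i inscribed in a circle
    (pair_sum_prod, crossed_quadrilateral), and so are the remaining
    orthogonality relations (triple_phase_relations). The triangle inequality
    needed for j = 3 holds because (lambda/2 - alpha_i)^2 - h_i^2 is a
    nonnegative constant (triangle_ineq). *)

(** * Indices and linear combinations *)

Lemma ord4_cases (P : 'I_4 -> Prop) : P 0 -> P 1 -> P 2 -> P 3 -> forall i, P i.
Proof.
move=> P0 P1 P2 P3 [[|[|[|[|//]]]] lti].
- by rewrite (_ : Ordinal lti = 0) //; apply: val_inj.
- by rewrite (_ : Ordinal lti = 1) //; apply: val_inj.
- by rewrite (_ : Ordinal lti = 2) //; apply: val_inj.
- by rewrite (_ : Ordinal lti = 3) //; apply: val_inj.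
Qed.

Lemma big_ord4 (T : Type) (idx : T) (op : Monoid.law idx) (F : 'I_4 -> T) :
  \big[op/idx]_(i < 4) F i = op (op (op (F 0) (F 1)) (F 2)) (F 3).
Proof.
rewrite !big_ord_recl big_ord0 Monoid.mulm1 !Monoid.mulmA.
by congr (op (op (op (F _) (F _)) (F _)) (F _)); apply: val_inj.
Qed.

Lemma big_ord4_perm (T : Type) (idx : T) (op : Monoid.com_law idx) (s : 'S_4)
    (F : 'I_4 -> T) :
  \big[op/idx]_(i < 4) F i =
  op (op (op (F (s 0)) (F (s 1))) (F (s 2))) (F (s 3)).
Proof. by rewrite (reindex_inj (@perm_inj _ s)) big_ord4. Qed.

(** The quadruple (x0, x1, x2, x3) as a function on the four indices; the
    default value of nth is never reached. *)
Definition of4 (T : Type) (x0 x1 x2 x3 : T) (i : 'I_4) : T :=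
  nth x0 [:: x0; x1; x2; x3] i.

(** Two forms of the remark that an equation holds as soon as it is a linear
    combination of known ones. *)
Lemma eq_lincomb1 (R : pzRingType) (c l r x y : R) :
  l = r -> x - y = c * (l - r) -> x = y.
Proof. by move=> -> /eqP; rewrite subrr mulr0 subr_eq0 => /eqP. Qed.

Lemma eq_lincomb2 (R : pzRingType) (c c' l r l' r' x y : R) :
  l = r -> l' = r' -> x - y = c * (l - r) + c' * (l' - r') -> x = y.
Proof.
by move=> -> -> /eqP; rewrite !subrr !mulr0 addr0 subr_eq0 => /eqP.
Qed.

(** * Unitary matrices and their complementary minors *)

Section Unitary.
Variable C : numClosedFieldType.

Lemma unitary_row_dot n (u : 'M[C]_n) (i j : 'I_n) : u \is unitarymx ->
  \sum_k u i k * (u j k)^* = (i == j)%:R.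
Proof.
move/unitarymxP/matrixP/(_ i j); rewrite !mxE => <-.
by apply: eq_bigr => k _; rewrite !mxE.
Qed.

Lemma unitary_col_dot n (u : 'M[C]_n) (i j : 'I_n) : u \is unitarymx ->
  \sum_k u k i * (u k j)^* = (i == j)%:R.
Proof.
rewrite -trmx_unitary => /unitary_row_dot <-.
by apply: eq_bigr => k _; rewrite !mxE.
Qed.

Lemma perm_mx_unitary n (s : 'S_n) : perm_mx s \is @unitarymx C n n.
Proof.
apply/unitarymxP; rewrite tr_perm_mx map_perm_mx.
by rewrite -perm_mxM mulgV perm_mx1.
Qed.

Lemma norm_det_unitary n (u : 'M[C]_n) : u \is unitarymx ->
  \det u * (\det u)^* = 1.
Proof.
move/unitarymxP/(congr1 determinant).
by rewrite det_mulmx det1 det_map_mx det_tr.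
Qed.

(** Jacobi's identity for complementary minors of a unitary matrix: multiply
    by the block triangular matrix with first block column (1, 0) and second
    block column the adjoint of the row (K, D), and take determinants. *)
Lemma unitary_block_minor m n (A : 'M[C]_m) (B : 'M[C]_(m, n))
    (K : 'M[C]_(n, m)) (D : 'M[C]_n) :
  block_mx A B K D \is unitarymx ->
  \det A = \det (block_mx A B K D) * (\det D)^*.
Proof.
move=> /unitarymxP; rewrite tr_block_mx map_block_mx mulmx_block.
rewrite scalar_mx_block => /eq_block_mx[_ ABKD _ KKDD].
have : block_mx A B K D *m
         block_mx 1%:M (map_mx Num.conj K^T) 0 (map_mx Num.conj D^T) =
       block_mx A 0 K 1%:M.
  by rewrite mulmx_block !mulmx1 !mulmx0 !addr0 ABKD KKDD.
move/(congr1 determinant); rewrite det_mulmx det_ublock det_lblock !det1.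
by rewrite mul1r mulr1 det_map_mx det_tr.
Qed.

Lemma det2 (A : 'M[C]_2) : \det A = A 0 0 * A 1 1 - A 0 1 * A 1 0.
Proof.
rewrite (expand_det_row _ 0) !big_ord_recl big_ord0 /cofactor !det_mx11 !mxE.
rewrite /= addr0 expr0 expr1 mul1r mulN1r mulrN.
by congr (A _ _ * A _ _ - A _ _ * A _ _); apply: val_inj.
Qed.

(** Jacobi's identity for arbitrary 2 x 2 minors of a 4 x 4 unitary matrix; the
    permutations s and t list the rows and the columns, those of the minor
    first. *)
Lemma unitary_minor (u : 'M[C]_4) (s t : 'S_4) : u \is unitarymx ->
  u (s 0) (t 0) * u (s 1) (t 1) - u (s 0) (t 1) * u (s 1) (t 0) =
  (-1) ^+ (s (+) t) * \det u *
    (u (s 2) (t 2) * u (s 3) (t 3) - u (s 2) (t 3) * u (s 3) (t 2))^*.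
Proof.
move=> unu; pose v : 'M[C]_(2 + 2) := row_perm s (col_perm t u).
have unv : v \is unitarymx.
  by rewrite /v row_permE col_permE !mul_unitarymx ?perm_mx_unitary.
have detv : \det v = (-1) ^+ (s (+) t) * \det u.
  rewrite /v row_permE col_permE !det_mulmx !det_perm odd_permV signr_addb.
  by rewrite -mulrA [\det u * _]mulrC.
have := unv; rewrite -[v]submxK => /unitary_block_minor.
rewrite submxK detv !det2 !mxE.
rewrite (_ : lshift 2 0 = 0) 1?(_ : lshift 2 1 = 1); try exact: val_inj.
rewrite (_ : rshift 2 0 = 2) 1?(_ : rshift 2 1 = 3); try exact: val_inj.
done.
Qed.

Lemma unitary_minor_offdiag (u : 'M[C]_4) (s : 'S_4) : u \is unitarymx ->
  u (s 0) (s 2) * u (s 1) (s 3) - u (s 0) (s 3) * u (s 1) (s 2) =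
  \det u * (u (s 2) (s 0) * u (s 3) (s 1) - u (s 2) (s 1) * u (s 3) (s 0))^*.
Proof.
move=> /(unitary_minor s ((tperm 0 2)%R * (tperm 1 3)%R * s)%g).
by rewrite !permM !odd_permM !odd_tperm !permE /= addbb expr0 mul1r.
Qed.

Lemma unitary_minor_mixed (u : 'M[C]_4) : u \is unitarymx ->
  u 0 0 * u 2 1 - u 0 1 * u 2 0 =
  - \det u * (u 1 2 * u 3 3 - u 1 3 * u 3 2)^*.
Proof.
move=> /(unitary_minor (tperm 1 2) 1%g).
by rewrite !odd_perm1 !odd_tperm !permE /= expr1 mulN1r.
Qed.

Lemma unitary_of_row_dot n (u : 'M[C]_n) :
  (forall i j, \sum_k u i k * (u j k)^* = (i == j)%:R) -> u \is unitarymx.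
Proof.
move=> rowu; apply/unitarymxP/matrixP => i j; rewrite !mxE -rowu.
by apply: eq_bigr => k _; rewrite !mxE.
Qed.

Lemma scale_rows_unitary n (u : 'M[C]_n) (e : 'I_n -> C) :
  u \is unitarymx -> (forall i, `|e i| = 1) ->
  \matrix_(i, j) (e i * u i j) \is unitarymx.
Proof.
move=> unu norme; apply: unitary_of_row_dot => i j.
rewrite (eq_bigr (fun k => e i * (e j)^* * (u i k * (u j k)^*))); last first.
  by move=> k _; rewrite !mxE rmorphM /= mulrACA.
rewrite -mulr_sumr unitary_row_dot //; case: eqVneq => [->|_].
  by rewrite -normCK norme expr1n mulr1.
by rewrite mulr0.
Qed.

End Unitary.

(** * Phases of the off-diagonal entries *)

Section Phases.
Variable C : numClosedFieldType.

Lemma norm_addC_colinear (x y : C) : x * y^* = `|x| * `|y| ->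
  `|x + y| = `|x| + `|y|.
Proof.
move=> xy; have yx : y * x^* = `|x| * `|y|.
  by rewrite -[LHS]conjCK rmorphM /= conjCK mulrC xy rmorphM /= !conj_normC.
apply/eqP; rewrite -(@eqrXn2 _ 2) ?addr_ge0 ?normr_ge0 //; apply/eqP.
rewrite normCK rmorphD /= mulrDl !mulrDr xy yx -!normCK.
by ring.
Qed.

(** Multiplying A - B = D conj (A' - B') by A' B', and the conjugate relation by
    A B, gives two equations between A - B and B' - A', from which A - B can be
    cancelled. *)
Lemma mul_of_conj_sub_eq (A B A' B' D P : C) :
  A * A^* = P -> B * B^* = P -> A' * A'^* = P -> B' * B'^* = P ->
  D * D^* = 1 -> A - B != 0 -> A - B = D * (A' - B')^* ->
  A * B * A' * B' = D ^+ 2 * P ^+ 2.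
Proof.
move=> AP BP AP' BP' DD AB0 AB.
have e1 : A' * B' * (A - B) = D * P * (B' - A').
  rewrite AB rmorphB /=.
  by apply: (eq_lincomb2 (c := D * B') (c' := - (D * A')) AP' BP'); ring.
have ABc : A^* - B^* = D^* * (A' - B').
  by rewrite -rmorphB /= AB rmorphM /= conjCK.
have e2 : D * P * (A - B) = A * B * (B' - A').
  have e : P * (A - B) = A * B * (B^* - A^*).
    by apply: (eq_lincomb2 (c := B) (c' := - A) AP BP); ring.
  apply: (eq_lincomb2 (c := D) (c' := A * B * (B' - A')) e DD).
  by apply: (eq_lincomb1 (c := - (D * A * B)) ABc); ring.
apply: (mulIf AB0).
by apply: (eq_lincomb2 (c := A * B) (c' := - (D * P)) e1 e2); ring.
Qed.

(** The computation behind phase_factors: here y1, y2, y3 are y_01, y_02, y_12,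
    and yj, yk are y_0j, y_0k. *)
Lemma phase_ratio (y1 y2 y3 yj yk yjk a0 aj ak c : C) :
  y1 != 0 -> y2 != 0 -> y3 != 0 -> yj != 0 -> yk != 0 -> c != 0 -> a0 != 0 ->
  c ^+ 2 = a0 ^+ 2 * y3 / (y1 * y2) -> y1 * y2 * yjk = yj * yk * y3 ->
  a0 * aj / (c * yj) * (a0 * ak / (c * yk)) * yjk = aj * ak.
Proof.
move=> y10 y20 y30 yj0 yk0 c0 a00 c2 E.
have -> : a0 * aj / (c * yj) * (a0 * ak / (c * yk)) * yjk =
   a0 ^+ 2 * aj * ak * yjk / (c ^+ 2 * (yj * yk)).
  by field; rewrite c0 yj0 yk0.
rewrite c2.
have -> : yjk = yj * yk * y3 / (y1 * y2).
  by rewrite -E; field; rewrite y10 y20.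
by field; rewrite y10 y20 y30 a00 yj0 yk0.
Qed.

(** A symmetric family y_ij of moduli a_i a_j comes from phases, in the form
    y_ij = a_i a_j / (e_i e_j), as soon as its products over the three pairings
    of the indices coincide. The factor e_0 is a square root of
    a_0^2 y_12 / (y_01 y_02), and y_0j dictates the others. *)
Lemma phase_factors (y : 'I_4 -> 'I_4 -> C) (a : 'I_4 -> C) :
  (forall i, 0 < a i) -> (forall i j, y i j = y j i) ->
  (forall i j, i != j -> `|y i j| = a i * a j) ->
  y 0 1 * y 2 3 = y 0 2 * y 1 3 -> y 0 2 * y 1 3 = y 0 3 * y 1 2 ->
  exists2 e : 'I_4 -> C, forall i, `|e i| = 1 &
    forall i j, i != j -> e i * e j * y i j = a i * a j.
Proof.
move=> a_gt0 ysym normy Y1 Y2.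
have y_neq0 i j : i != j -> y i j != 0.
  by move=> ij; rewrite -normr_gt0 normy ?mulr_gt0.
have a_neq0 i : a i != 0 by rewrite gt_eqF.
pose e0 := sqrtC (a 0 ^+ 2 * y 1 2 / (y 0 1 * y 0 2)).
have e02 : e0 ^+ 2 = a 0 ^+ 2 * y 1 2 / (y 0 1 * y 0 2) by rewrite sqrtCK.
have norme0 : `|e0| = 1.
  apply/eqP; rewrite -(@eqrXn2 _ 2) ?normr_ge0 ?ler01 // -normrX e02.
  rewrite normrM normfV !normrM !normy // ger0_norm ?ltW // expr1n.
  apply/eqP; move: (a_neq0 0) (a_neq0 1) (a_neq0 2).
  by move: (a 0) (a 1) (a 2) => x1 x2 x3 ? ? ?; field; apply/and3P.
have e0_neq0 : e0 != 0 by rewrite -normr_gt0 norme0 ltr01.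
pose e j := if j == 0 then e0 else a 0 * a j / (e0 * y 0 j).
have e_neq0 j : j != 0 -> e j = a 0 * a j / (e0 * y 0 j).
  by rewrite /e => /negbTE ->.
have sym i j : e i * e j * y i j = a i * a j -> e j * e i * y j i = a j * a i.
  by rewrite ysym [e j * _]mulrC [a j * _]mulrC.
have e0j k : k != 0 -> e 0 * e k * y 0 k = a 0 * a k.
  move=> k0; rewrite (e_neq0 k) // /e eqxx.
  by rewrite mulrAC mulrC divfK // mulf_neq0 // y_neq0 // eq_sym.
have y01 := y_neq0 0 1 isT; have y02 := y_neq0 0 2 isT.
have y03 := y_neq0 0 3 isT; have y12 := y_neq0 1 2 isT.
(* For nonzero j and k the claim amounts to an equality between products of the
   values of y; it is trivial for {j, k} = {1, 2}. *)
have ejk j k : j != 0 -> k != 0 -> j != k ->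
    y 0 1 * y 0 2 * y j k = y 0 j * y 0 k * y 1 2 ->
    e j * e k * y j k = a j * a k.
  move=> j0 k0 jk; rewrite !e_neq0 //.
  have := y_neq0 0 j; rewrite eq_sym => /(_ j0).
  have := y_neq0 0 k; rewrite eq_sym => /(_ k0).
  by move=> yk0 yj0 E; apply: phase_ratio e02 E.
have e12 : e 1 * e 2 * y 1 2 = a 1 * a 2 by apply: ejk.
have e13 : e 1 * e 3 * y 1 3 = a 1 * a 3.
  apply: ejk => //; rewrite -mulrA Y2.
  by move: (y 0 1) (y 0 3) (y 1 2) => *; ring.
have e23 : e 2 * e 3 * y 2 3 = a 2 * a 3.
  apply: ejk => //; rewrite mulrAC Y1 mulrAC -mulrA.
  by rewrite mulrC Y2; move: (y 0 2) (y 0 3) (y 1 2) => *; ring.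
exists e.
  move=> j; rewrite /e; case: eqVneq => // j0.
  rewrite normrM normfV !normrM norme0 mul1r normy 1?eq_sym //.
  by rewrite !(@ger0_norm _ (a _)) ?ltW // divff // mulf_neq0.
elim/ord4_cases; elim/ord4_cases => // _; try exact: e0j.
all: try (by apply/sym/e0j).
all: try exact: e12.
all: try exact: e13.
all: try exact: e23.
all: exact: sym.
Qed.

(** In this section a and d stand for alpha and delta, embedded in C. *)
Section Moduli.
Variables (u : 'M[C]_4) (a d : 'I_4 -> C).
Hypothesis unu : u \is unitarymx.
Hypothesis a_gt0 : forall i, 0 < a i.
Hypothesis norm_diag : forall i, `|u i i| = d i.
Hypothesis norm_offdiag : forall i j, i != j -> `|u i j| ^+ 2 = a i * a j.

Lemma offdiag_minor_neq0 (s : 'S_4) :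
  d (s 0) + d (s 1) < a (s 2) + a (s 3) ->
  u (s 0) (s 2) * u (s 1) (s 3) - u (s 0) (s 3) * u (s 1) (s 2) != 0.
Proof.
have sneq (i j : 'I_4) : i != j -> s i != s j.
  by move=> ij; rewrite (inj_eq perm_inj).
have s01 := sneq 0 1 isT; have s02 := sneq 0 2 isT; have s03 := sneq 0 3 isT.
have s12 := sneq 1 2 isT; have s13 := sneq 1 3 isT; have s10 := sneq 1 0 isT.
move: (unitary_row_dot (s 0) (s 1) unu).
rewrite (negbTE s01) mulr0n (big_ord4_perm _ s) /=.
move: (s 0) (s 1) (s 2) (s 3) s01 s02 s03 s12 s13 s10 => i j k l.
move=> ij ik il jk jl ji orth lt_da; apply: contraTneq lt_da => /eqP.
rewrite subr_eq0 => /eqP minor0.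
have normM x y : x != y -> `|u x y| = sqrtC (a x * a y).
  by move=> xy; rewrite -norm_offdiag // exprCK.
(* The modulus of u_ij, equal to that of u_ji, is a common factor of the four
   terms of the orthogonality relation. *)
set m := `|u i j|.
have m_gt0 : 0 < m by rewrite /m normM // sqrtC_gt0 mulr_gt0.
have mji : `|u j i| = m by rewrite /m !normM // mulrC.
have normx x : i != x -> j != x -> `|u i x * (u j x)^*| = m * a x.
  move=> ix jx; rewrite normrM norm_conjC !normM //.
  rewrite -rootCMl ?mulr_ge0 ?ltW //.
  rewrite (_ : _ * _ = (a i * a j) * a x ^+ 2); last by ring.
  by rewrite rootCMl ?mulr_ge0 ?ltW // exprCK ?ltW // /m normM.
have colin : `|u i k * (u j k)^* + u i l * (u j l)^*| = m * (a k + a l).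
  rewrite norm_addC_colinear ?normx // ?mulrDr //.
  rewrite rmorphM /= conjCK.
  have -> : u i k * (u j k)^* * ((u i l)^* * u j l) =
            (u i k * u j l) * (u j k)^* * (u i l)^* by ring.
  rewrite minor0.
  have -> : u i l * u j k * (u j k)^* * (u i l)^* =
            (u i l * (u i l)^*) * (u j k * (u j k)^*) by ring.
  rewrite -!normCK !norm_offdiag //.
  have m2 : m ^+ 2 = a i * a j by rewrite norm_offdiag.
  by apply: (eq_lincomb1 (c := - (a k * a l)) m2); ring.
apply/negP => lt_da; move: colin.
have -> : u i k * (u j k)^* + u i l * (u j l)^* =
          - (u i i * (u j i)^* + u i j * (u j j)^*).
  by apply: (eq_lincomb1 (c := 1) orth); ring.
rewrite normrN => colin.
have := ler_normD (u i i * (u j i)^*) (u i j * (u j j)^*).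
rewrite colin !normrM !norm_conjC mji !norm_diag -/m [d i * m]mulrC -mulrDr.
by rewrite ler_pM2l // => /(lt_le_trans lt_da); rewrite ltxx.
Qed.

(** The right-hand side does not depend on s. *)
Lemma twocycle_prod (s : 'S_4) :
  d (s 0) + d (s 1) < a (s 2) + a (s 3) ->
  (u (s 0) (s 2) * u (s 2) (s 0)) * (u (s 1) (s 3) * u (s 3) (s 1)) *
  ((u (s 0) (s 3) * u (s 3) (s 0)) * (u (s 1) (s 2) * u (s 2) (s 1))) =
  \det u ^+ 2 * (\prod_i a i) ^+ 2.
Proof.
move=> /offdiag_minor_neq0 minor0.
have sneq (i j : 'I_4) : i != j -> s i != s j.
  by move=> ij; rewrite (inj_eq perm_inj).
rewrite (big_ord4_perm _ s) /=.
have P (i j k l : 'I_4) : s i != s j -> s k != s l ->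
    (u (s i) (s j) * u (s k) (s l)) * (u (s i) (s j) * u (s k) (s l))^* =
    a (s i) * a (s j) * (a (s k) * a (s l)).
  by move=> ij kl; rewrite -normCK normrM exprMn !norm_offdiag.
have -> : forall x y z t x' y' z' t' : C,
  (x * y) * (z * t) * ((x' * y') * (z' * t')) =
  (x * z) * (x' * z') * (y * t) * (t' * y') by move=> *; ring.
apply: mul_of_conj_sub_eq minor0 (unitary_minor_offdiag s unu);
  rewrite ?norm_det_unitary ?P ?sneq //;
  move: (a (s 0)) (a (s 1)) (a (s 2)) (a (s 3)) => *; ring.
Qed.

(** Multiplying the rows by suitable phases makes u Hermitian off the
    diagonal. *)
Lemma hermitian_gauge :
  (u 0 1 * u 1 0) * (u 2 3 * u 3 2) = (u 0 2 * u 2 0) * (u 1 3 * u 3 1) ->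
  (u 0 2 * u 2 0) * (u 1 3 * u 3 1) = (u 0 3 * u 3 0) * (u 1 2 * u 2 1) ->
  exists2 e : 'I_4 -> C, forall i, `|e i| = 1 &
    forall i j, i != j -> e i * u i j = (e j * u j i)^*.
Proof.
move=> Y1 Y2.
have [||||e norme eey] := phase_factors (y := fun i j => u i j * u j i) a_gt0.
- by move=> i j; rewrite mulrC.
- move=> i j ij; rewrite normrM; apply/eqP.
  rewrite -(@eqrXn2 _ 2) ?mulr_ge0 ?normr_ge0 ?ltW //.
  by rewrite exprMn !norm_offdiag // 1?eq_sym // expr2 [a j * _]mulrC.
- exact: Y1.
- exact: Y2.
exists e => // i j ij.
have uji : u j i != 0.
  apply: contraTneq (mulr_gt0 (a_gt0 j) (a_gt0 i)) => u0.
  by rewrite -norm_offdiag 1?eq_sym // u0 normr0 expr0n ltxx.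
apply: (mulfI (_ : e j != 0)); first by rewrite -normr_gt0 norme ltr01.
apply: (mulIf uji); rewrite rmorphM /=.
have -> : e j * (e i * u i j) * u j i = a i * a j by rewrite -eey //; ring.
have -> : e j * ((e j)^* * (u j i)^*) * u j i =
  e j * (e j)^* * (u j i * (u j i)^*) by ring.
by rewrite -!normCK norme expr1n mul1r norm_offdiag 1?eq_sym // mulrC.
Qed.

End Moduli.

Section HermitianOffdiag.
Variable (v : 'M[C]_4).
Hypothesis unv : v \is unitarymx.
Hypothesis herm : forall i j, i != j -> v i j = (v j i)^*.
Hypothesis v_neq0 : forall i j, i != j -> v i j != 0.

(** The orthogonality relations of the rows i, j and of the columns i, j differ
    only in the terms that contain diagonal entries. *)
Lemma hermitian_offdiag_im (i j : 'I_4) :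
  v i i - (v i i)^* = v j j - (v j j)^*.
Proof.
have [-> //|ij] := eqVneq i j; have ji : j != i by rewrite eq_sym.
have := unitary_col_dot j i unv; rewrite (negbTE ji) mulr0n.
rewrite (bigD1 i) //= (bigD1 j) //= -(herm ij).
rewrite (eq_bigr (fun k => v i k * (v j k)^*)); last first.
  by move=> k /andP[ki kj]; rewrite -herm 1?eq_sym // (herm kj) mulrC.
have := unitary_row_dot i j unv; rewrite (negbTE ij) mulr0n.
rewrite (bigD1 i) //= (bigD1 j) //= -(herm ij).
set S := \sum_(_ < _ | _) _ => row col.
apply: (mulIf (v_neq0 ij)).
by apply: (eq_lincomb2 (c := 1) (c' := -1) row col); ring.
Qed.

(** Both sides of Jacobi's identity for the rows 0, 1 and the columns 2, 3
    involve the same minor, so that the determinant is 1. Then the identity for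
    the rows 0, 2 and the columns 0, 1, added to the orthogonality relation of
    rows 2 and 1, becomes a multiple of v_21. *)
Lemma hermitian_offdiag_trace :
  v 0 2 * v 1 3 - v 0 3 * v 1 2 != 0 ->
  v 0 0 + (v 1 1)^* + v 2 2 + (v 3 3)^* = 0.
Proof.
move=> minor0.
have detv : \det v = 1.
  have := unitary_minor_offdiag 1 unv; rewrite !perm1.
  rewrite rmorphB !rmorphM /= -!herm // => e.
  apply: (mulIf minor0); rewrite mul1r [RHS]e; congr (_ * _).
  by rewrite [v 1 2 * _]mulrC.
have hermC i j : i != j -> (v i j)^* = v j i.
  by move=> ij; rewrite -herm 1?eq_sym.
have := unitary_minor_mixed unv; rewrite detv rmorphB !rmorphM /=.
rewrite (hermC 1 2) // (hermC 1 3) // (hermC 3 2) //.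
have := unitary_row_dot 2 1 unv; rewrite big_ord4 /= mulr0n.
rewrite (hermC 1 0) // (hermC 1 2) // (hermC 1 3) //.
move=> row minor; apply: (mulIf (v_neq0 (isT : 2 != 1 :> 'I_4))).
move: (v 0 0) (v 1 1)^* (v 2 2) (v 3 3)^* row minor.
move: (v 0 1) (v 2 0) (v 2 1) (v 2 3) (v 3 1) => b c e f g x y z t row minor.
by apply: (eq_lincomb2 (c := 1) (c' := 1) row minor); ring.
Qed.

End HermitianOffdiag.

(** The numbers z_i are the diagonal entries of u multiplied by phases; they have
    the same imaginary part, and their real parts add up to 0. *)
Lemma unitary_diag_relations (u : 'M[C]_4) (a d : 'I_4 -> C) :
  u \is unitarymx -> (forall i, 0 < a i) ->
  (forall i, `|u i i| = d i) ->
  (forall i j, i != j -> `|u i j| ^+ 2 = a i * a j) ->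
  (forall s : 'S_4, d (s 0) + d (s 1) < a (s 2) + a (s 3)) ->
  exists z : 'I_4 -> C,
    [/\ forall i, `|z i| = d i,
        forall i j, z i - (z i)^* = z j - (z j)^*
      & z 0 + (z 1)^* + z 2 + (z 3)^* = 0].
Proof.
move=> unu a_gt0 norm_diag norm_offdiag lt_da.
have u_neq0 i j : i != j -> u i j != 0.
  move=> ij; apply: contraTneq (mulr_gt0 (a_gt0 i) (a_gt0 j)) => u0.
  by rewrite -norm_offdiag // u0 normr0 expr0n ltxx.
(* With Y_1 = y_01 y_23, Y_2 = y_02 y_13 and Y_3 = y_03 y_12, these are the values
   of Y_2 Y_3, Y_1 Y_3 and Y_2 Y_1. *)
have Y1 := twocycle_prod unu a_gt0 norm_diag norm_offdiag (lt_da 1%g).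
have Y2 := twocycle_prod unu a_gt0 norm_diag norm_offdiag (lt_da (tperm 1 2)).
have Y3 := twocycle_prod unu a_gt0 norm_diag norm_offdiag (lt_da (tperm 1 3)).
rewrite !perm1 in Y1; rewrite !permE /= in Y2 Y3.
have [e norme herm] : exists2 e : 'I_4 -> C, forall i, `|e i| = 1 &
    forall i j, i != j -> e i * u i j = (e j * u j i)^*.
  have y_neq0 i j : i != j -> u i j * u j i != 0.
    by move=> ij; rewrite mulf_neq0 ?u_neq0 // eq_sym.
  apply: (hermitian_gauge a_gt0 norm_offdiag).
    have y03 := y_neq0 0 3 isT; have y12 := y_neq0 1 2 isT.
    apply: (mulIf (mulf_neq0 y03 y12)); rewrite Y1 -Y2.
    by rewrite [u 2 1 * _]mulrC.
  have y01 := y_neq0 0 1 isT; have y23 := y_neq0 2 3 isT.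
  apply: (mulIf (mulf_neq0 y01 y23)).
  rewrite [u 2 3 * _]mulrC [u 1 3 * _]mulrC Y3 -Y2.
  by rewrite [u 2 3 * _]mulrC [u 2 1 * _]mulrC [LHS]mulrC.
pose v := \matrix_(i, j) (e i * u i j).
have unv : v \is unitarymx by apply: scale_rows_unitary.
have e_neq0 i : e i != 0 by rewrite -normr_gt0 norme ltr01.
have v_neq0 i j : i != j -> v i j != 0.
  by move=> ij; rewrite mxE mulf_neq0 ?u_neq0.
have hermv i j : i != j -> v i j = (v j i)^* by move=> ij; rewrite !mxE herm.
exists (fun i => v i i); split.
- by move=> i; rewrite mxE normrM norme mul1r.
- by move=> i j; apply: hermitian_offdiag_im.
apply: hermitian_offdiag_trace => //.
have := offdiag_minor_neq0 unu a_gt0 norm_diag norm_offdiag (lt_da 1%g).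
rewrite !perm1 !mxE => minor0.
have -> : forall x y p q r s : C, x * p * (y * q) - x * r * (y * s) =
  x * y * (p * q - r * s) by move=> *; ring.
by rewrite !mulf_neq0.
Qed.

End Phases.

(** * From vanishing sums to the inequalities and back *)

Section DiagInequalities.
Variable R : realFieldType.
Implicit Types h k d s : R.

Lemma cauchy_schwarz_plane h k s d e : 0 <= d -> 0 <= e ->
  d ^+ 2 = h ^+ 2 + s ^+ 2 -> e ^+ 2 = k ^+ 2 + s ^+ 2 ->
  h * k + s ^+ 2 <= d * e.
Proof.
move=> d0 e0 dE eE; apply: le_trans (ler_norm _) _.
rewrite -(@ler_pXn2r _ 2) ?nnegrE ?normr_ge0 ?mulr_ge0 //.
rewrite -normrX ger0_norm ?sqr_ge0 // exprMn dE eE.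
have := sqr_ge0 (s * (h - k)); lra.
Qed.

(** Convexity of k |-> sqrt (k^2 + s^2) on nonnegative numbers, in the form of an
    inequality for k0 >= k1 >= k2 >= k3: by hypothesis k2 - k3 <= k0 - k1, and
    the slope (k2 + k3) / (d2 + d3) is at most (k0 + k1) / (d0 + d1). *)
Lemma sqrt_sub_convex k0 k1 k2 k3 d0 d1 d2 d3 s :
  [/\ 0 < d0, 0 < d1, 0 < d2 & 0 < d3] ->
  [/\ d0 ^+ 2 = k0 ^+ 2 + s ^+ 2, d1 ^+ 2 = k1 ^+ 2 + s ^+ 2,
      d2 ^+ 2 = k2 ^+ 2 + s ^+ 2 & d3 ^+ 2 = k3 ^+ 2 + s ^+ 2] ->
  [/\ 0 <= k3, k3 <= k2, k2 <= k1 & k1 <= k0] -> k1 + k2 <= k0 + k3 ->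
  d1 + d2 <= d0 + d3.
Proof.
move=> [d00 d10 d20 d30] [d0E d1E d2E d3E] [k30 k32 k21 k10] kk.
have slope x y p q : 0 <= y -> y <= x -> 0 < p -> 0 < q ->
    p ^+ 2 = x ^+ 2 + s ^+ 2 -> q ^+ 2 = y ^+ 2 + s ^+ 2 -> y * p <= x * q.
  move=> y0 yx p0 q0 pE qE.
  have x0 : 0 <= x by lra.
  rewrite -(@ler_pXn2r _ 2) ?nnegrE ?mulr_ge0 ?(ltW p0) ?(ltW q0) //.
  have ysxs : y ^+ 2 * s ^+ 2 <= x ^+ 2 * s ^+ 2.
    by rewrite ler_wpM2r ?sqr_ge0 // ler_pXn2r ?nnegrE.
  by rewrite !exprMn pE qE; lra.
have sl : (k2 + k3) * (d0 + d1) <= (k0 + k1) * (d2 + d3).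
  have h1 : k2 * d0 <= k0 * d2 by apply: slope => //; lra.
  have h2 : k2 * d1 <= k1 * d2 by apply: slope => //; lra.
  have h3 : k3 * d0 <= k0 * d3 by apply: slope => //; lra.
  have h4 : k3 * d1 <= k1 * d3 by apply: slope => //; lra.
  lra.
suff : (d2 - d3) * ((d0 + d1) * (d2 + d3)) <=
       (d0 - d1) * ((d0 + d1) * (d2 + d3)).
  by rewrite ler_pM2r ?mulr_gt0 ?addr_gt0 //; lra.
have e23 : (d2 - d3) * (d2 + d3) = (k2 - k3) * (k2 + k3).
  by rewrite -!subr_sqr d2E d3E; ring.
have e01 : (d0 - d1) * (d0 + d1) = (k0 - k1) * (k0 + k1).
  by rewrite -!subr_sqr d0E d1E; ring.
have -> : (d2 - d3) * ((d0 + d1) * (d2 + d3)) =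
          (k2 - k3) * ((k2 + k3) * (d0 + d1)).
  by rewrite mulrA mulrAC e23 mulrA.
have -> : (d0 - d1) * ((d0 + d1) * (d2 + d3)) =
          (k0 - k1) * ((k0 + k1) * (d2 + d3)).
  by rewrite mulrA e01 mulrA.
apply: le_trans (_ : (k2 - k3) * ((k0 + k1) * (d2 + d3)) <= _).
  by rewrite ler_wpM2l //; lra.
by rewrite ler_wpM2r //; [rewrite mulr_ge0 //; lra | lra].
Qed.

Lemma norm_sum0_le h0 h1 h2 h3 : h0 + h1 + h2 + h3 = 0 ->
  [/\ `|h3| <= `|h2|, `|h2| <= `|h1| & `|h1| <= `|h0|] ->
  `|h1| + `|h2| <= `|h0| + `|h3|.
Proof.
move=> sum0 [].
by case: (ger0P h0); case: (ger0P h1); case: (ger0P h2); case: (ger0P h3); lra.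
Qed.

Lemma sum0_diag_ineq h0 h1 h2 h3 s d0 d1 d2 d3 :
  [/\ d1 <= d0, d2 <= d1, d3 <= d2 & 0 < d3] ->
  [/\ d0 ^+ 2 = h0 ^+ 2 + s ^+ 2, d1 ^+ 2 = h1 ^+ 2 + s ^+ 2,
      d2 ^+ 2 = h2 ^+ 2 + s ^+ 2 & d3 ^+ 2 = h3 ^+ 2 + s ^+ 2] ->
  h0 + h1 + h2 + h3 = 0 ->
  d0 - d1 - d2 - d3 <= 0 /\ 0 <= d0 - d1 - d2 + d3.
Proof.
move=> [d10 d21 d32 d30] [d0E d1E d2E d3E] sum0.
have [d0p d1p d2p] : [/\ 0 < d0, 0 < d1 & 0 < d2] by split; lra.
split.
  suff : d0 <= d1 + d2 + d3 by lra.
  rewrite -(@ler_pXn2r _ 2) ?nnegrE //; try lra.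
  have c12 := cauchy_schwarz_plane (ltW d1p) (ltW d2p) d1E d2E.
  have c13 := cauchy_schwarz_plane (ltW d1p) (ltW d30) d1E d3E.
  have c23 := cauchy_schwarz_plane (ltW d2p) (ltW d30) d2E d3E.
  have h0E : h0 = - (h1 + h2 + h3) by lra.
  have s20 := sqr_ge0 s.
  have -> : (d1 + d2 + d3) ^+ 2 = d1 ^+ 2 + d2 ^+ 2 + d3 ^+ 2 +
     2 * (d1 * d2 + d1 * d3 + d2 * d3) by ring.
  rewrite d0E d1E d2E d3E h0E; lra.
suff : d1 + d2 <= d0 + d3 by lra.
have le_norm x y p q : 0 < q -> q <= p -> p ^+ 2 = x ^+ 2 + s ^+ 2 ->
    q ^+ 2 = y ^+ 2 + s ^+ 2 -> `|y| <= `|x|.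
  move=> q0 qp pE qE; rewrite -ler_sqr ?nnegrE // !real_normK ?num_real //.
  rewrite -(lerD2r (s ^+ 2)) -pE -qE ler_sqr ?nnegrE //; lra.
have hh := norm_sum0_le sum0.
have [l32 l21 l10] : [/\ `|h3| <= `|h2|, `|h2| <= `|h1| & `|h1| <= `|h0|].
  by split; [apply: le_norm d3E|apply: le_norm d2E|apply: le_norm d1E]; eauto.
apply: (@sqrt_sub_convex `|h0| `|h1| `|h2| `|h3| _ _ _ _ s) => //.
  by split; rewrite real_normK ?num_real.
exact: hh.
Qed.

End DiagInequalities.

Section Root.
Import numFieldNormedType.Exports.
Variable R : realType.

Lemma continuous_sqrt_add_sqr (c : R) :
  continuous (fun x : R => Num.sqrt (c + x ^+ 2)).
Proof.
move=> x; apply: continuous_comp; last exact: sqrt_continuous.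
apply: continuousD; first exact: cvg_cst.
exact: exprn_continuous.
Qed.

(** The converse of sum0_diag_ineq. The root x is the value of h3, and
    s^2 = d3^2 - x^2; at x = - d3 and x = d3 the sum of the h_i is equal to the
    two expressions of the hypotheses. *)
Lemma sum0_of_diag_ineq (d0 d1 d2 d3 : R) :
  [/\ d1 <= d0, d2 <= d1, d3 <= d2 & 0 < d3] ->
  d0 - d1 - d2 - d3 <= 0 -> 0 <= d0 - d1 - d2 + d3 ->
  exists h0 h1 h2 h3 s : R,
    [/\ [/\ d0 ^+ 2 = h0 ^+ 2 + s ^+ 2, d1 ^+ 2 = h1 ^+ 2 + s ^+ 2,
            d2 ^+ 2 = h2 ^+ 2 + s ^+ 2 & d3 ^+ 2 = h3 ^+ 2 + s ^+ 2],
        h0 + h1 + h2 + h3 = 0, h1 <= 0, h2 <= 0 & 0 < h0 + h3].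
Proof.
move=> [d10 d21 d32 d30] le0 ge0.
(* This case, which contains that of equal d_i, is apart because h0 + h3 might
   vanish at a root. *)
have [eq0|neq0] := eqVneq (d0 - d1 - d2 + d3) 0.
  exists d0, (- d1), (- d2), d3, 0; rewrite !expr0n /= !sqrrN !addr0.
  by split=> //; lra.
pose f i (x : R) := Num.sqrt (i ^+ 2 - d3 ^+ 2 + x ^+ 2).
pose G x := f d0 x - f d1 x - f d2 x + x.
have f_end i x : d3 <= i -> x ^+ 2 = d3 ^+ 2 -> f i x = i.
  move=> di xE; rewrite /f xE subrK sqrtr_sqr ger0_norm //; lra.
have [x x_itv Gx] : exists2 x, x \in `[- d3, d3] & G x = 0.
  apply: IVT; first by lra.
    apply: continuous_subspaceT => x.
    have cf i : {for x, continuous (f i)} := @continuous_sqrt_add_sqr _ x.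
    apply: cvgD; last exact: cvg_id.
    by apply: cvgB; [apply: cvgB|]; apply: cf.
  rewrite /G !f_end ?sqrrN //; try lra.
  by rewrite ge_min le_max le0 ge0 orbT.
move: x_itv; rewrite in_itv /= => /andP[lex xle].
have x2 : x ^+ 2 <= d3 ^+ 2 by nra.
have sqr_le i : d3 <= i -> d3 ^+ 2 <= i ^+ 2 by move=> ?; nra.
have f_sqr i : d3 <= i -> i ^+ 2 = f i x ^+ 2 + (d3 ^+ 2 - x ^+ 2).
  move=> di; rewrite sqr_sqrtr; first by ring.
  by have := sqr_le _ di; have := sqr_ge0 x; lra.
have f_ge0 i : 0 <= f i x by rewrite sqrtr_ge0.
have d31 : d3 <= d1 by lra.
have d3_0 : d3 <= d0 by lra.
have sE : Num.sqrt (d3 ^+ 2 - x ^+ 2) ^+ 2 = d3 ^+ 2 - x ^+ 2.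
  by rewrite sqr_sqrtr // subr_ge0.
exists (f d0 x), (- f d1 x), (- f d2 x), x, (Num.sqrt (d3 ^+ 2 - x ^+ 2)).
split; rewrite ?oppr_le0 ?f_ge0 //.
  by rewrite !sqrrN sE; split; rewrite -?f_sqr //; ring.
have -> : f d0 x + x = f d1 x + f d2 x by move: Gx; rewrite /G; lra.
rewrite lt_neqAle addr_ge0 // andbT eq_sym paddr_eq0 //.
apply: contraNN neq0 => /andP[/eqP f1 /eqP f2].
(* If h0 + h3 = 0 then all the d_i are equal, which was excluded. *)
have xx := sqr_ge0 x.
have := f_sqr _ d31; have := f_sqr _ d32; have := f_sqr _ d3_0.
rewrite f1 f2 expr0n /= => d0E d2E d1E.
have [d2d3 d1d3] : d2 = d3 /\ d1 = d3.
  split; apply/eqP; rewrite -(@eqrXn2 _ 2) //; try lra;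
    rewrite eq_le ?sqr_le // andbT; lra.
have x0 : x ^+ 2 = 0 by move: d2E; rewrite d2d3; lra.
have xE : x = 0 by apply/eqP; rewrite -sqrf_eq0 x0.
have : f d0 x = 0 by move: Gx; rewrite /G f1 f2 xE; lra.
move=> f0; suff -> : d0 = d3 by rewrite d1d3 d2d3; apply/eqP; lra.
apply/eqP; rewrite -(@eqrXn2 _ 2) //; try lra.
by rewrite d0E f0 x0; apply/eqP; lra.
Qed.

End Root.

(** * Inscribed quadrilaterals *)

(** Both sides are equal to half of h0^2 + h1^2 - h2^2 - h3^2. *)
Lemma pair_sum_prod (R : numFieldType) (h0 h1 h2 h3 a0 a1 a2 a3 L t : R) :
  h0 + h1 + h2 + h3 = 0 -> a0 + a1 + a2 + a3 = L ->
  [/\ h0 ^+ 2 = a0 ^+ 2 - L * a0 + t, h1 ^+ 2 = a1 ^+ 2 - L * a1 + t,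
      h2 ^+ 2 = a2 ^+ 2 - L * a2 + t & h3 ^+ 2 = a3 ^+ 2 - L * a3 + t] ->
  (h0 + h2) * (h0 + h3) = a2 * a3 - a0 * a1.
Proof.
move=> sum0 <- [h0E h1E h2E h3E].
apply: (mulfI (_ : 2 != 0)); first by rewrite pnatr_eq0.
have -> : 2 * ((h0 + h2) * (h0 + h3)) =
    h0 ^+ 2 + (h0 + h2 + h3) ^+ 2 - h2 ^+ 2 - h3 ^+ 2 by ring.
have -> : h0 + h2 + h3 = - h1 by apply: (eq_lincomb1 (c := 1) sum0); ring.
by rewrite sqrrN h0E h1E h2E h3E; ring.
Qed.

Lemma le_add_of_sqr (R : realFieldType) (x y k l : R) :
  0 <= y -> 0 <= k -> 0 <= l -> x ^+ 2 <= y ^+ 2 + k ^+ 2 -> x <= y + l + k.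
Proof.
move=> y0 k0 l0 le; have [x0|x0] := leP x 0; first by lra.
rewrite -(@ler_pXn2r _ 2) ?nnegrE ?addr_ge0 ?(ltW x0) //; apply: le_trans le _.
have -> : (y + l + k) ^+ 2 =
  y ^+ 2 + k ^+ 2 + (l * (l + 2 * y + 2 * k) + 2 * (y * k)) by ring.
by rewrite lerDl addr_ge0 ?mulr_ge0 ?addr_ge0 ?ler0n ?mulr_ge0.
Qed.

Section Triangle.
Variable R : rcfType.

(** The complex numbers f_j = x_j + i y_j are the phases of the entries (2,3),
    (3,1), (1,2) of H; the linear relations are the real and imaginary parts of
      a + a2 conj f_3 + a3 f_2 = 0,  b + a1 f_3 + a3 conj f_1 = 0,
      p + a1 conj f_2 + a2 f_1 = 0,
    which say that row 0 of H is orthogonal to the others when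
    a = h_0 + h_1, b = h_0 + h_2 and p = h_0 + h_3. *)
Lemma crossed_quadrilateral (a0 a1 a2 a3 a b p : R) :
  [/\ 0 < a0, 0 < a1, 0 < a2 & 0 < a3] -> 0 < p ->
  [/\ b * p = a2 * a3 - a0 * a1, p * a = a1 * a3 - a0 * a2
    & a * b = a1 * a2 - a0 * a3] ->
  a1 - a2 <= p -> a2 - a1 <= p -> p <= a1 + a2 ->
  exists x1 y1 x2 y2 x3 y3 : R,
   [/\ [/\ x1 ^+ 2 + y1 ^+ 2 = 1, x2 ^+ 2 + y2 ^+ 2 = 1
        & x3 ^+ 2 + y3 ^+ 2 = 1],
       [/\ a + a2 * x3 + a3 * x2 = 0, b + a1 * x3 + a3 * x1 = 0
         & p + a1 * x2 + a2 * x1 = 0] &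
       [/\ a2 * y3 = a3 * y2, a1 * y3 = a3 * y1 & a1 * y2 = a2 * y1]].
Proof.
move=> [a00 a10 a20 a30] p0 [bp pa ab] tri1 tri2 tri3.
have [pn0 a1n0 a2n0] : [/\ p != 0, a1 != 0 & a2 != 0] by split; rewrite gt_eqF.
(* The law of cosines in the triangle with sides p, a1, a2. *)
pose c1 := (a1 ^+ 2 - p ^+ 2 - a2 ^+ 2) / (2 * p * a2).
pose c2 := (a2 ^+ 2 - p ^+ 2 - a1 ^+ 2) / (2 * p * a1).
have c1E : 2 * p * a2 * c1 = a1 ^+ 2 - p ^+ 2 - a2 ^+ 2.
  by rewrite /c1; field; rewrite ?pn0 ?a1n0 ?a2n0.
have c2E : 2 * p * a1 * c2 = a2 ^+ 2 - p ^+ 2 - a1 ^+ 2.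
  by rewrite /c2; field; rewrite ?pn0 ?a1n0 ?a2n0.
have c1_le1 : 0 <= 1 - c1 ^+ 2.
  have pa2 : 0 < (2 * p * a2) ^+ 2 by rewrite exprn_gt0 // !mulr_gt0.
  rewrite -(pmulr_rge0 _ pa2).
  have -> : (2 * p * a2) ^+ 2 * (1 - c1 ^+ 2) =
    (a1 - p + a2) * (a1 + p - a2) * ((p + a2 - a1) * (p + a2 + a1)).
    by rewrite mulrBr -exprMn c1E; ring.
  by rewrite !mulr_ge0 //; lra.
pose y1 := Num.sqrt (1 - c1 ^+ 2).
have y1E : y1 ^+ 2 = 1 - c1 ^+ 2 by rewrite sqr_sqrtr.
pose c3 := - (a + a3 * c2) / a2.
have c3E : a2 * c3 = - (a + a3 * c2) by rewrite /c3; field.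
have pc : p + a1 * c2 + a2 * c1 = 0.
  apply: (mulfI (_ : 2 * p != 0)); first by rewrite mulf_neq0 ?pnatr_eq0.
  move: c1E c2E; lra.
have bc : b + a1 * c3 + a3 * c1 = 0.
  apply: (mulfI (_ : 2 * p * a2 != 0)); first by rewrite !mulf_neq0 ?pnatr_eq0.
  have h1 : a2 * (b * p) = a2 * (a2 * a3 - a0 * a1) by rewrite bp.
  have h2 : a1 * (p * a) = a1 * (a1 * a3 - a0 * a2) by rewrite pa.
  have h3 := congr1 ( *%R a3) c1E; have h4 := congr1 ( *%R a3) c2E.
  have h5 := congr1 ( *%R (a1 * p)) c3E.
  move: h1 h2 h3 h4 h5 => /=; lra.
have a1sqr : p ^+ 2 + 2 * p * (a2 * c1) + a2 ^+ 2 = a1 ^+ 2 by move: c1E; lra.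
(* The law of cosines in the triangle with sides |b|, a3, a1 yields the same angle;
   this is where the three product relations are used. *)
have a1sqr' : b ^+ 2 + 2 * b * (a3 * c1) + a3 ^+ 2 = a1 ^+ 2.
  apply: (mulfI (_ : p ^+ 2 * a2 != 0)); first by rewrite mulf_neq0 ?expf_neq0.
  have -> : p ^+ 2 * a2 * (b ^+ 2 + 2 * b * (a3 * c1) + a3 ^+ 2) =
      (b * p) ^+ 2 * a2 + (b * p) * a3 * (2 * p * a2 * c1) +
      p ^+ 2 * a2 * a3 ^+ 2 by ring.
  rewrite c1E bp.
  have pqn : p ^+ 2 * (a1 * a2 - a0 * a3) =
             (a2 * a3 - a0 * a1) * (a1 * a3 - a0 * a2).
    by rewrite -ab -bp -pa; ring.
  by move: (congr1 ( *%R a1) pqn) => /=; lra.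
exists c1, y1, c2, (a2 / a1 * y1), c3, (a3 / a1 * y1).
have unit t m c : t + a1 * c + m * c1 = 0 ->
    t ^+ 2 + 2 * t * (m * c1) + m ^+ 2 = a1 ^+ 2 ->
    c ^+ 2 + (m / a1 * y1) ^+ 2 = 1.
  move=> lin quad; apply: (mulfI (_ : a1 ^+ 2 != 0)); first by rewrite expf_neq0.
  rewrite mulr1 -[RHS]quad exprMn y1E.
  have -> : a1 ^+ 2 * (c ^+ 2 + (m / a1) ^+ 2 * (1 - c1 ^+ 2)) =
    (a1 * c) ^+ 2 + m ^+ 2 * (1 - c1 ^+ 2) by field.
  have -> : a1 * c = - (t + m * c1) by move: lin; lra.
  by ring.
split; last by split; field.
  split; first by rewrite y1E; ring.
    by apply: (unit p); [move: pc; lra|move: a1sqr; lra].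
  exact: (unit b).
by split=> //; rewrite c3E; ring.
Qed.

End Triangle.

(** The orthogonality of rows 1, 2, 3 to each other, deduced from that of row 0 to
    them; g_j stands for the conjugate of f_j. *)
Lemma triple_phase_relations (C : fieldType)
    (a0 a1 a2 a3 a b p f1 f2 g1 g2 g3 : C) :
  a2 != 0 -> p * a = a1 * a3 - a0 * a2 -> f2 * g2 = 1 ->
  a + a2 * g3 + a3 * f2 = 0 -> b + a1 * g3 + a3 * f1 = 0 ->
  p + a1 * g2 + a2 * f1 = 0 -> p + a1 * f2 + a2 * g1 = 0 ->
  [/\ a0 + a3 * (f1 * f2) = p * g3, a0 + a1 * (g2 * g3) = a * f1
    & a0 + a2 * (g1 * g3) = b * f2].
Proof.
move=> a20 pa fg2 e1 e2 e3 e3'.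
have k1 : a0 + a3 * (f1 * f2) = p * g3.
  apply: (mulfI a20).
  have k : a1 + a2 * f1 * f2 = - p * f2.
    by apply: (eq_lincomb2 (c := f2) (c' := - a1) e3 fg2); ring.
  apply: (eq_lincomb2 (c := a3) (c' := - p) k e1).
  by apply: (eq_lincomb1 (c := 1) pa); ring.
split=> //.
  apply: (eq_lincomb2 (c := 1) (c' := - f1) k1 e1).
  by apply: (eq_lincomb1 (c := g3) e3); ring.
apply: (eq_lincomb2 (c := 1) (c' := - f2) k1 e2).
by apply: (eq_lincomb1 (c := g3) e3'); ring.
Qed.

(** * The matrix H + i s *)

Section Matrix.
Variables (R : rcfType) (h v : 'I_4 -> R) (s : R) (F : 'I_4 -> 'I_4 -> R[i]).
Local Notation "x %:C" := (real_complex R x).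
Hypothesis hermF : forall i j, (F i j)^* = F j i.
Hypothesis normF : forall i j, i != j -> F i j * F j i = 1.
Hypothesis row_norm :
  forall i, h i ^+ 2 + s ^+ 2 + v i ^+ 2 * \sum_(k | k != i) v k ^+ 2 = 1.
Hypothesis row_orth : forall i j, i != j ->
  (h i + h j)%:C * F i j +
  \sum_(k | (k != i) && (k != j)) (v k ^+ 2)%:C * (F i k * F k j) = 0.

(** The matrix H + i s, where H has diagonal h and off-diagonal entries
    v_i v_j F_ij. The diagonal values of F are irrelevant. *)
Definition hermitian_shift_mx : 'M[R[i]]_4 :=
  \matrix_(i, j) if i == j then Complex (h i) s else (v i * v j)%:C * F i j.

Lemma hermitian_shift_mx_unitary : hermitian_shift_mx \is unitarymx.
Proof.
have conjR (x : R) : (x%:C)^* = x%:C by exact: conjc_real.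
apply: unitary_of_row_dot => i j; have [->|ij] := eqVneq i j.
  rewrite (bigD1 j) //= mxE eqxx.
  rewrite (eq_bigr (fun k => (v j ^+ 2 * v k ^+ 2)%:C)); last first.
    move=> k kj; rewrite mxE [j == k]eq_sym (negbTE kj) [(_ * _)^*]rmorphM.
    rewrite [X in _ * (X * _)]conjR [X in _ * (_ * X)]hermF.
    have -> : (v j * v k)%:C * F j k * ((v j * v k)%:C * F k j) =
       (v j * v k)%:C ^+ 2 * (F j k * F k j) by ring.
    by rewrite normF 1?eq_sym // mulr1 -rmorphXn exprMn.
  rewrite -rmorph_sum -mulr_sumr -normCK -add_Re2_Im2 -rmorphD /=.
  by rewrite row_norm rmorph1.
rewrite (bigD1 i) //= (bigD1 j) 1?eq_sym //= !mxE !eqxx [j == i]eq_sym.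
rewrite (negbTE ij) [(_%:C * _)^*]rmorphM.
rewrite [X in Complex (h i) s * (X * _)]conjR.
rewrite [X in Complex (h i) s * (_ * X)]hermF.
rewrite (eq_bigr (fun k => (v i * v j)%:C * ((v k ^+ 2)%:C * (F i k * F k j)))).
  rewrite -mulr_sumr.
  have -> : Complex (h i) s * ((v j * v i)%:C * F i j) +
     ((v i * v j)%:C * F i j * (Complex (h j) s)^* +
      (v i * v j)%:C *
        \sum_(k | (k != i) && (k != j)) (v k ^+ 2)%:C * (F i k * F k j)) =
     (v i * v j)%:C * ((Complex (h i) s + (Complex (h j) s)^*) * F i j +
       \sum_(k | (k != i) && (k != j)) (v k ^+ 2)%:C * (F i k * F k j)).
    by rewrite [v j * _]mulrC; ring.
  have -> : Complex (h i) s + (Complex (h j) s)^* = (h i + h j)%:C.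
    by apply/eqP; rewrite eq_complex /= eqxx subrr eqxx.
  by rewrite row_orth // mulr0.
move=> k /andP[ki kj]; rewrite !mxE [i == k]eq_sym [j == k]eq_sym.
rewrite (negbTE ki) (negbTE kj) [(_ * _)^*]rmorphM.
rewrite [X in _ * (X * _)]conjR [X in _ * (_ * X)]hermF !rmorphM /=.
by ring.
Qed.

End Matrix.

(** * The equivalence *)

Local Open Scope complex_scope.

Section Setting.
Variables (R : realType) (alpha : 'I_4 -> R).
Local Notation L := (lambda alpha).
Local Notation d := (delta alpha).
Hypothesis L_gt2 : 2 < L.
Hypothesis alpha_le_root : forall i, alpha i <= (L - Num.sqrt (L ^+ 2 - 4)) / 2.
Hypothesis delta_gt0 : forall i, 0 < d i.
Hypothesis alpha_gt0 : forall i, 0 < alpha i.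

Lemma lambda_sqr_gt4 : 4 < L ^+ 2.
Proof.
have : 0 < (L - 2) * (L + 2) by rewrite mulr_gt0 //; move: L_gt2; lra.
lra.
Qed.

Lemma delta_sqr i : d i ^+ 2 = alpha i ^+ 2 - L * alpha i + 1.
Proof. by rewrite sqr_sqrtr // ltW // -sqrtr_gt0; apply: delta_gt0. Qed.

Lemma alpha_lt_half i : alpha i < L / 2.
Proof.
apply: le_lt_trans (alpha_le_root i) _.
have : 0 < Num.sqrt (L ^+ 2 - 4) by rewrite sqrtr_gt0 subr_gt0 lambda_sqr_gt4.
lra.
Qed.

Lemma delta_lt_beta i : d i < L / 2 - alpha i.
Proof.
have ai := alpha_lt_half i; have di := delta_gt0 i; have dE := delta_sqr i.
have bi : 0 <= L / 2 - alpha i by lra.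
rewrite -(@ltr_pXn2r _ 2) ?nnegrE ?(ltW di) // dE.
have := lambda_sqr_gt4; lra.
Qed.

Lemma delta_add_lt (s : 'S_4) :
  d (s 0) + d (s 1) < alpha (s 2) + alpha (s 3).
Proof.
have LE : L = alpha (s 0) + alpha (s 1) + alpha (s 2) + alpha (s 3).
  exact: big_ord4_perm.
have := delta_lt_beta (s 0); have := delta_lt_beta (s 1); lra.
Qed.

Lemma diag_ineq_of_unitary (u : 'M[R[i]]_4) :
  [/\ d 1 <= d 0, d 2 <= d 1 & d 3 <= d 2] ->
  u \is unitarymx -> (forall i, `|u i i| = (d i)%:C) ->
  (forall i j, i != j -> `|u i j| = (Num.sqrt (alpha i * alpha j))%:C) ->
  d 0 - d 1 - d 2 - d 3 <= 0 /\ 0 <= d 0 - d 1 - d 2 + d 3.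
Proof.
move=> [d10 d21 d32] unu norm_diag norm_offdiag.
have [||||z [normz imz sumz]] := unitary_diag_relations
  (a := fun i => (alpha i)%:C) (d := fun i => (d i)%:C) unu.
- by move=> i; rewrite ltcR.
- exact: norm_diag.
- move=> i j ij; rewrite norm_offdiag // -rmorphXn /= sqr_sqrtr ?rmorphM //.
  by rewrite mulr_ge0 // ltW.
- by move=> s; rewrite -!rmorphD /= ltcR delta_add_lt.
have zE i : d i ^+ 2 = complex.Re (z i) ^+ 2 + complex.Im (z i) ^+ 2.
  have /complexI <- :
      (Num.sqrt (complex.Re (z i) ^+ 2 + complex.Im (z i) ^+ 2))%:C = (d i)%:C.
    by rewrite -normc_def normz.
  by rewrite sqr_sqrtr // addr_ge0 ?sqr_ge0.
have imE i : complex.Im (z i) = complex.Im (z 0).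
  have := imz i 0; case: (z i) (z 0) => x y [x' y'] [_ yy'] /=; lra.
have reE :
    complex.Re (z 0) + complex.Re (z 1) + complex.Re (z 2) + complex.Re (z 3) = 0.
  move: sumz.
  by case: (z 0) (z 1) (z 2) (z 3) => ? ? [? ?] [? ?] [? ?] [].
apply: (sum0_diag_ineq (s := complex.Im (z 0))) reE => //.
by split; rewrite zE // imE.
Qed.

(** The triangle inequality for the lengths h0 + h3, alpha_1, alpha_2. With
    beta_i = L / 2 - alpha_i, the difference beta_i^2 - h_i^2 is a nonnegative
    constant and alpha_1 + alpha_2 = beta_0 + beta_3. *)
Lemma triangle_ineq (h0 h1 h2 h3 s : R) :
  [/\ d 0 ^+ 2 = h0 ^+ 2 + s ^+ 2, d 1 ^+ 2 = h1 ^+ 2 + s ^+ 2,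
      d 2 ^+ 2 = h2 ^+ 2 + s ^+ 2 & d 3 ^+ 2 = h3 ^+ 2 + s ^+ 2] ->
  h0 + h1 + h2 + h3 = 0 -> h1 <= 0 -> h2 <= 0 ->
  [/\ alpha 1 - alpha 2 <= h0 + h3, alpha 2 - alpha 1 <= h0 + h3
    & h0 + h3 <= alpha 1 + alpha 2].
Proof.
move=> [d0E d1E d2E d3E] sum0 h10 h20.
have LE : L = alpha 0 + alpha 1 + alpha 2 + alpha 3 by exact: big_ord4.
have L4 := lambda_sqr_gt4.
have s20 := sqr_ge0 s.
have betaE i : (L / 2 - alpha i) ^+ 2 = d i ^+ 2 + (L ^+ 2 / 4 - 1).
  by rewrite delta_sqr; field.
have beta_gt0 i : 0 < L / 2 - alpha i.
  by have := alpha_lt_half i; lra.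
have b0 := beta_gt0 0; have b1 := beta_gt0 1; have b2 := beta_gt0 2.
have b3 := beta_gt0 3.
have b0E := betaE 0; have b1E := betaE 1; have b2E := betaE 2.
have b3E := betaE 3.
split.
- have : L / 2 - alpha 2 <= (L / 2 - alpha 1) + (- h1) + (- h2).
    apply: le_add_of_sqr; rewrite ?oppr_ge0 ?(ltW b1) // sqrrN b1E b2E.
    by have := sqr_ge0 h1; lra.
  by lra.
- have : L / 2 - alpha 1 <= (L / 2 - alpha 2) + (- h2) + (- h1).
    apply: le_add_of_sqr; rewrite ?oppr_ge0 ?(ltW b2) // sqrrN b1E b2E.
    by have := sqr_ge0 h2; lra.
  by lra.
have le_beta i h : d i ^+ 2 = h ^+ 2 + s ^+ 2 -> h <= L / 2 - alpha i.
  move=> dE; apply: le_trans (ler_norm h) _.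
  rewrite -ler_sqr ?nnegrE ?normr_ge0 ?(ltW (beta_gt0 i)) //.
  by rewrite real_normK ?num_real // betaE dE; lra.
by have := le_beta 0 h0 d0E; have := le_beta 3 h3 d3E; lra.
Qed.

Lemma unitary_of_diag_ineq :
  [/\ d 1 <= d 0, d 2 <= d 1 & d 3 <= d 2] ->
  d 0 - d 1 - d 2 - d 3 <= 0 -> 0 <= d 0 - d 1 - d 2 + d 3 ->
  exists u : 'M[R[i]]_4,
  [/\ u \is unitarymx, forall i, `|u i i| = (d i)%:C
    & forall i j, i != j -> `|u i j| = (Num.sqrt (alpha i * alpha j))%:C].
Proof.
move=> [d10 d21 d32] le0 ge0.
have [h0 [h1 [h2 [h3 [s [dE sum0 h10 h20 p_gt0]]]]]] :
    exists h0 h1 h2 h3 s : R,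
    [/\ [/\ d 0 ^+ 2 = h0 ^+ 2 + s ^+ 2, d 1 ^+ 2 = h1 ^+ 2 + s ^+ 2,
            d 2 ^+ 2 = h2 ^+ 2 + s ^+ 2 & d 3 ^+ 2 = h3 ^+ 2 + s ^+ 2],
        h0 + h1 + h2 + h3 = 0, h1 <= 0, h2 <= 0 & 0 < h0 + h3].
  exact: sum0_of_diag_ineq.
have [tri1 tri2 tri3] := triangle_ineq dE sum0 h10 h20.
have [d0E d1E d2E d3E] := dE.
have LE : alpha 0 + alpha 1 + alpha 2 + alpha 3 = L by rewrite /lambda big_ord4.
have hE i h : d i ^+ 2 = h ^+ 2 + s ^+ 2 ->
    h ^+ 2 = alpha i ^+ 2 - L * alpha i + (1 - s ^+ 2).
  by rewrite delta_sqr => e; rewrite addrA e addrK.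
have := hE _ _ d0E; have := hE _ _ d1E; have := hE _ _ d2E; have := hE _ _ d3E.
move=> h3E h2E h1E h0E.
have bp : (h0 + h2) * (h0 + h3) = alpha 2 * alpha 3 - alpha 0 * alpha 1.
  exact: (pair_sum_prod sum0 LE (And4 h0E h1E h2E h3E)).
have pa : (h0 + h3) * (h0 + h1) = alpha 1 * alpha 3 - alpha 0 * alpha 2.
  rewrite mulrC; apply: (@pair_sum_prod _ h0 h2 h1 h3 _ _ _ _ L (1 - s ^+ 2)).
  - lra.
  - lra.
  - by split.
have ab : (h0 + h1) * (h0 + h2) = alpha 1 * alpha 2 - alpha 0 * alpha 3.
  apply: (@pair_sum_prod _ h0 h3 h1 h2 _ _ _ _ L (1 - s ^+ 2)).
  - lra.
  - lra.
  - by split.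
have [|x1 [y1 [x2 [y2 [x3 [y3 [[n1 n2 n3] [r1 r2 r3] [i1 i2 i3]]]]]]]] :=
    crossed_quadrilateral _ p_gt0 (And3 bp pa ab) tri1 tri2 tri3.
  by split.
pose f1 := Complex x1 y1; pose g1 := Complex x1 (- y1).
pose f2 := Complex x2 y2; pose g2 := Complex x2 (- y2).
pose f3 := Complex x3 y3; pose g3 := Complex x3 (- y3).
pose h := of4 h0 h1 h2 h3.
pose v i := Num.sqrt (alpha i).
(* F i j is the phase of the entry (i, j) of H. *)
pose F i j : R[i] := of4 (of4 1 1 1 1 j) (of4 1 1 f3 g2 j) (of4 1 g3 1 f1 j)
                         (of4 1 f2 g1 1 j) i.
have cE (x y : R[i]) :
    complex.Re x = complex.Re y -> complex.Im x = complex.Im y -> x = y.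
  by case: x y => ? ? [? ?] /= -> ->.
have norm1 (x y : R) :
    x ^+ 2 + y ^+ 2 = 1 -> Complex x y * Complex x (- y) = 1.
  by move=> n; apply: cE => /=; rewrite -?n; ring.
have norm1' (x y : R) :
    x ^+ 2 + y ^+ 2 = 1 -> Complex x (- y) * Complex x y = 1.
  by rewrite mulrC; apply: norm1.
have lin (t m m' x y x' y' : R) :
    t + m * x + m' * x' = 0 -> m * y + m' * y' = 0 ->
    t%:C + m%:C * Complex x y + m'%:C * Complex x' y' = 0.
  by move=> re im; apply: cE => /=; [rewrite -[RHS]re|rewrite -[RHS]im]; ring.
have e1 : (h0 + h1)%:C + (alpha 2)%:C * g3 + (alpha 3)%:C * f2 = 0.
  by apply: lin => //; rewrite mulrN i1 addNr.
have e2 : (h0 + h2)%:C + (alpha 1)%:C * g3 + (alpha 3)%:C * f1 = 0.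
  by apply: lin => //; rewrite mulrN i2 addNr.
have e3 : (h0 + h3)%:C + (alpha 1)%:C * g2 + (alpha 2)%:C * f1 = 0.
  by apply: lin => //; rewrite mulrN i3 addNr.
have e3' : (h0 + h3)%:C + (alpha 1)%:C * f2 + (alpha 2)%:C * g1 = 0.
  by apply: lin => //; rewrite mulrN i3 addrN.
have [k1 k2 k3] : [/\
    (alpha 0)%:C + (alpha 3)%:C * (f1 * f2) = (h0 + h3)%:C * g3,
    (alpha 0)%:C + (alpha 1)%:C * (g2 * g3) = (h0 + h1)%:C * f1
  & (alpha 0)%:C + (alpha 2)%:C * (g1 * g3) = (h0 + h2)%:C * f2].
  have a2n0 : (alpha 2)%:C != 0.
    by apply/eqP => - [a2_0]; have := alpha_gt0 2; rewrite a2_0 ltxx.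
  have paC : (h0 + h3)%:C * (h0 + h1)%:C =
      (alpha 1)%:C * (alpha 3)%:C - (alpha 0)%:C * (alpha 2)%:C.
    by rewrite -!rmorphM -rmorphB pa.
  exact: (triple_phase_relations a2n0 paC (norm1 _ _ n2) e1 e2 e3 e3').
have vE i : v i ^+ 2 = alpha i by rewrite sqr_sqrtr // ltW.
have conjE (x y : R) : Num.conj (Complex x y) = Complex x (- y) by [].
have hermF i j : Num.conj (F i j) = F j i.
  rewrite /F; elim/ord4_cases: i; elim/ord4_cases: j;
    rewrite /of4 /= ?rmorph1 //; by rewrite [LHS]conjE opprK.
have normF i j : i != j -> F i j * F j i = 1.
  rewrite /F; elim/ord4_cases: i; elim/ord4_cases: j => // _;
    rewrite /of4 /= ?mul1r //; by [apply: norm1 | apply: norm1'].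
have hsE i : h i ^+ 2 + s ^+ 2 = d i ^+ 2.
  by elim/ord4_cases: i; rewrite ?d0E ?d1E ?d2E ?d3E.
exists (hermitian_shift_mx h v s F); split.
- apply: hermitian_shift_mx_unitary => //.
    move=> i; rewrite hsE (eq_bigr alpha) // vE delta_sqr.
    rewrite {1}/lambda (bigD1 i) //=; ring.
  pose P i j := (h i + h j)%:C * F i j +
    \sum_(k | (k != i) && (k != j)) (v k ^+ 2)%:C * (F i k * F k j) = 0.
  (* P j i is the conjugate of P i j, so that six cases suffice. *)
  have Psym i j : P i j -> P j i.
    move=> /(congr1 Num.conj) Pij; rewrite /P -[RHS](rmorph0 Num.conj) -[RHS]Pij.
    rewrite [RHS]rmorphD; congr (_ + _).
      by rewrite [RHS]rmorphM /= hermF [X in _ = X * _]conjc_real [h j + _]addrC.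
    rewrite [RHS]rmorph_sum; apply: eq_big => [k|k _]; first by rewrite andbC.
    rewrite [RHS]rmorphM [X in _ = X * _]conjc_real [X in _ = _ * X]rmorphM /=.
    by rewrite !hermF [F k i * _]mulrC.
  have PE i j : (h i + h j)%:C * F i j +
      \sum_k (if (k != i) && (k != j) then
                (alpha k)%:C * (F i k * F k j) else 0) = 0 -> P i j.
    move=> e; rewrite /P -[RHS]e big_mkcond; congr (_ + _).
    by apply: eq_bigr => k _; rewrite vE.
  have P01 : P 0 1.
    apply: PE; rewrite big_ord4 /F /h /of4 /=.
    by rewrite !add0r !mul1r mulr1 addrA.
  have P03 : P 0 3.
    apply: PE; rewrite big_ord4 /F /h /of4 /=.
    by rewrite !add0r !mul1r mulr1 addr0 addrA.
  have P20 : P 2 0.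
    apply: PE; rewrite big_ord4 /F /h /of4 /=.
    by rewrite add0r addr0 !mulr1 [h2 + h0]addrC addrA.
  have P21 : P 2 1.
    apply: PE; rewrite big_ord4 /F /h /of4 /=.
    rewrite mul1r mulr1 !addr0 k1 -mulrDl -rmorphD /=.
    by rewrite (_ : h2 + h1 + (h0 + h3) = 0) ?mul0r //; move: sum0; lra.
  have P23 : P 2 3.
    apply: PE; rewrite big_ord4 /F /h /of4 /=.
    rewrite mul1r mulr1 !addr0 [g3 * g2]mulrC k2 -mulrDl -rmorphD /=.
    by rewrite (_ : h2 + h3 + (h0 + h1) = 0) ?mul0r //; move: sum0; lra.
  have P31 : P 3 1.
    apply: PE; rewrite big_ord4 /F /h /of4 /=.
    rewrite mul1r mulr1 !addr0 k3 -mulrDl -rmorphD /=.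
    by rewrite (_ : h3 + h1 + (h0 + h2) = 0) ?mul0r //; move: sum0; lra.
  move=> i j; elim/ord4_cases: i; elim/ord4_cases: j => // _;
    rewrite -/(P _ _) //; exact: Psym.
- move=> i; rewrite mxE eqxx normc_def /= hsE sqrtr_sqr ger0_norm //.
  by rewrite ltW.
move=> i j ij; rewrite mxE (negbTE ij) normrM.
have -> : `|F i j| = 1.
  apply/eqP; rewrite -(@eqrXn2 _ 2) ?normr_ge0 ?ler01 // normCK hermF normF //.
  by rewrite expr1n.
rewrite mulr1 -sqrtrM ?ltW // ger0_norm //.
by rewrite lecR sqrtr_ge0.
Qed.

End Setting.

Theorem theorem4p11 (R : realType) (alpha : 'I_4 -> R)
  (alpha_gt0 : 0 < alpha 0)
  (alpha_sorted : [/\ alpha 0 <= alpha 1, alpha 1 <= alpha 2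
                    & alpha 2 <= alpha 3])
  (lambda_gt2 : 2 < lambda alpha)
  (alpha_le_root : forall i : 'I_4,
     alpha i <= (lambda alpha - Num.sqrt (lambda alpha ^+ 2 - 4)) / 2)
  (delta_sorted : [/\ delta alpha 0 >= delta alpha 1,
                      delta alpha 1 >= delta alpha 2,
                      delta alpha 2 >= delta alpha 3
                    & delta alpha 3 > 0]) :
  (exists u : 'M[R[i]]_4,
     [/\ u \is unitarymx,
         forall i : 'I_4, `|u i i| = (delta alpha i)%:C
       & forall i j : 'I_4, i != j ->
           `|u i j| = (Num.sqrt (alpha i * alpha j))%:C])
  <->
  (delta alpha 0 - delta alpha 1 - delta alpha 2 - delta alpha 3 <= 0 /\
   delta alpha 0 - delta alpha 1 - delta alpha 2 + delta alpha 3 >= 0).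
Proof.
have [a01 a12 a23] := alpha_sorted; have [d10 d21 d32 d3_gt0] := delta_sorted.
have a_gt0 i : 0 < alpha i by elim/ord4_cases: i; lra.
have d_gt0 i : 0 < delta alpha i by elim/ord4_cases: i; lra.
split=> [[u [unu norm_diag norm_offdiag]]|[le0 ge0]].
  exact: (diag_ineq_of_unitary lambda_gt2 alpha_le_root d_gt0 a_gt0 _ unu).
exact: unitary_of_diag_ineq.
Qed.
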